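(* Let $n\ge 3$, let $K_n$ be the complete graph on $n$ vertices, and let $J(m,r)$ be the Johnson graph with $r\ge 1$, $m\ge 2r$ and $m\ge 3$. Let the distinct adjacency eigenvalues of $J(m,r)$ be $\lambda_i=(r-i)(m-r-i)-i$ for $i=0,1,\ldots,r$, and its distinct distance eigenvalues be $\mu_0=s$, $\mu_1=-\frac{s}{m-1}$, $\mu_2=0$, where $s=\sum_{j=0}^{r} j k_j$ and $k_j=\binom{r}{j}\binom{m-r}{j}$ for $j=0,1,\ldots,r$. Then the distance eigenvalues of $K_n\otimes J(m,r)$ are $2n-2+ns+\lambda_0$, $2n-2-\frac{ns}{m-1}+\lambda_1$, $2n-2+\lambda_i$ for $i=2,3,\ldots,r$, and $\lambda_i-2$ for $i=0,1,\ldots,r$.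
   Context: The Johnson graph $J(m,r)$ has as vertices all $r$-element subsets of an $m$-element set, two vertices being adjacent if and only if they intersect in exactly $r-1$ elements. The Kronecker product $G\otimes H$ of simple graphs $G,H$ has vertex set $V(G)\times V(H)$, with $(x,y)$ adjacent to $(u,v)$ if and only if $xu\in E(G)$ and $yv\in E(H)$. Distance eigenvalues are the eigenvalues of the distance matrix, whose $(u,v)$ entry is the length of a shortest $u$–$v$ path. *)

(* Defs.v *)
From HB Require Import structures.
From mathcomp Require Import all_boot all_order all_algebra.
Set Implicit Arguments. Unset Strict Implicit. Unset Printing Implicit Defensive.
Import Order.TTheory GRing.Theory Num.Theory.

(* A simple graph is an (irreflexive, symmetric) boolean relation on a finType. *)

Definition walkb (T : finType) (e : rel T) (k : nat) (x y : T) : bool :=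
  [exists s : k.-tuple T, path e x s && (last x s == y)].

(* graph distance: length of a shortest walk from x to y
   (a shortest walk, if any, has fewer than #|T| edges; convention #|T| if
   y is unreachable, which never happens for connected graphs) *)
Definition gdist (T : finType) (e : rel T) (x y : T) : nat :=
  find (fun k => walkb e k x y) (iota 0 #|T|).

Definition distmx (R : pzRingType) (T : finType) (e : rel T) : 'M[R]_#|T| :=
  \matrix_(i, j) ((gdist e (enum_val i) (enum_val j))%:R)%R.

Definition complete_rel (n : nat) : rel 'I_n := fun x y => x != y.

Definition johnson_V (m r : nat) := {A : {set 'I_m} | #|A| == r}.
Definition johnson_rel (m r : nat) : rel (johnson_V m r) :=
  fun A B => #|val A :&: val B| == r.-1.

Definition kron_rel (T1 T2 : finType) (e1 : rel T1) (e2 : rel T2) : rel (T1 * T2) :=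
  fun x y => e1 x.1 y.1 && e2 x.2 y.2.

(* Main.v *)
Require Import Defs.
From HB Require Import structures.
From mathcomp Require Import all_boot all_order all_algebra perm.
From mathcomp Require Import ring lra zify.
Import Order.TTheory GRing.Theory Num.Theory.

(** Write d for the Johnson distance r - |A :&: B|. In the Kronecker product
    the distance from (x, A) to (y, B) is
      d(A, B) + [x = y][A ~ B] + 2 [x <> y][A = B],
    so with J the all-ones matrix the distance matrix is
      J (x) D + I (x) N + 2 (J - I) (x) I,
    where D and N are the distance and adjacency matrices of the Johnson graph.
    Rather than diagonalising D and N, use the indicator functions
    w_S(B) = [S \subset B], filtered by |S|: N w_S equals lambda_|S| w_S plus
    a combination of the w_(S - x), and D w_S is a combination of w_0 and
    the w_x only, since d(A, B) = r - sum_(y in B) [y \in A]. Tensoring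
    with the constant function and the indicators of the points of K_n makes
    the whole distance matrix triangular for one filtration of functionals, whose
    diagonal gives the eigenvalues. An entry on the diagonal is attained because
    some function annihilated by all lower functionals is not annihilated at
    that level: prod_i ([a_i \in B] - [b_i \in B]) for |S| disjoint pairs. *)

(** * Walks and graph distance *)

Lemma walkb0 {T : finType} (e : rel T) x y : walkb e 0 x y = (x == y).
Proof.
apply/existsP/eqP => [[s]|->]; first by rewrite tuple0 /= => /eqP.
by exists [tuple]; rewrite /= eqxx.
Qed.

Lemma walkbS {T : finType} (e : rel T) k x y :
  walkb e k.+1 x y = [exists z, e x z && walkb e k z y].
Proof.
apply/existsP/existsP => [[s] | [z /andP [xz /existsP [s /andP [p l]]]]].
  case/tupleP: s => z s /= /andP [/andP [xz p] l].
  by exists z; rewrite xz; apply/existsP; exists s; rewrite p.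
by exists [tuple of z :: s]; rewrite /= xz p.
Qed.

Lemma walkb1 {T : finType} (e : rel T) x y : walkb e 1 x y = e x y.
Proof.
rewrite walkbS; apply/existsP/idP => [[z]|xy]; first by rewrite walkb0 => /andP [xz /eqP <-].
by exists y; rewrite walkb0 xy eqxx.
Qed.

(* A shortest walk repeats no vertex, so it fits in the range searched by [gdist]. *)
Lemma gdist_shortest {T : finType} (e : rel T) k x y :
  walkb e k x y -> (forall j, (j < k)%N -> ~~ walkb e j x y) -> gdist e x y = k.
Proof.
move=> kw kmin.
have kT : (k < #|T|)%N.
  have /existsP [s /andP [p /eqP l]] := kw.
  have := l; case: (shortenP p) => s' p' us' ss' l'.
  have sk : (size s' <= k)%N.
    by rewrite -(size_tuple s); apply: uniq_leq_size => //; case/andP: us'.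
  have ws' : walkb e (size s') x y.
    by apply/existsP; exists (in_tuple s'); rewrite /= p' l' eqxx.
  have -> : k = size s'.
    by apply/eqP; rewrite eqn_leq sk andbT leqNgt; apply/negP => /kmin; rewrite ws'.
  by have := card_uniqP us'; rewrite /= => <-; apply: max_card.
rewrite /gdist.
have kin : (k < size (iota 0 #|T|))%N by rewrite size_iota.
apply/eqP; rewrite eqn_leq; apply/andP; split.
  rewrite leqNgt; apply/negP => kf.
  by have := before_find 0%N kf; rewrite nth_iota // add0n kw.
rewrite leqNgt; apply/negP => kf.
have hf : has (fun k => walkb e k x y) (iota 0 #|T|).
  by rewrite has_find; apply: ltn_trans kin.
have := nth_find 0%N hf; rewrite nth_iota ?add0n; last first.
  by rewrite -[X in (_ < X)%N](size_iota 0) -has_find.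
by rewrite (negPf (kmin _ kf)).
Qed.

(** This makes the product distance the least length realised by walks in both factors at once. *)
Lemma walkb_kron {T1 T2 : finType} (e1 : rel T1) (e2 : rel T2) k x y :
  walkb (kron_rel e1 e2) k x y = walkb e1 k x.1 y.1 && walkb e2 k x.2 y.2.
Proof.
elim: k x => [|k IH] [x1 x2] /=; first by rewrite !walkb0 -pair_eqE.
rewrite !walkbS; apply/existsP/andP.
  move=> [[z1 z2]]; rewrite IH /kron_rel /= => /andP [/andP [a b] /andP [c d]].
  by split; apply/existsP; [exists z1 | exists z2]; rewrite ?a ?b.
move=> [/existsP [z1 /andP [a b]] /existsP [z2 /andP [c d]]].
by exists (z1, z2); rewrite IH /kron_rel /= a b c.
Qed.

(** A third vertex, different from both ends, gives length 2; longer walks start with an arbitrary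
    step. *)
Lemma walkb_complete (n k : nat) (x y : 'I_n) :
  (3 <= n)%N -> (2 <= k)%N -> walkb (@complete_rel n) k x y.
Proof.
move=> hn; elim: k x => // -[|[|k]] IH x // _; last first.
  have [z xz] : exists z, z != x.
    have : (0 < #|predC1 x|)%N by rewrite cardC1 card_ord; lia.
    by case/card_gt0P => z; rewrite inE => ?; exists z.
  rewrite walkbS; apply/existsP; exists z; rewrite IH // andbT.
  by rewrite /complete_rel eq_sym.
have : (0 < #|~: [set x; y]|)%N.
  by have := cardsC [set x; y]; rewrite cards2 card_ord; case: (x != y); lia.
case/card_gt0P => z; rewrite !inE negb_or => /andP [zx zy].
rewrite walkbS; apply/existsP; exists z.
by rewrite walkb1 /complete_rel zy eq_sym zx.
Qed.

(** * Distances in the Johnson graph and in the product *)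

Definition blk {m r : nat} (A : johnson_V m r) : {set 'I_m} := val A.

Section Johnson.
Context {m r : nat}.
Notation V := (johnson_V m r).
Implicit Types (A B C : V) (S : {set 'I_m}).

Lemma card_blk A : #|blk A| = r.
Proof. by case: A => A hA; apply/eqP. Qed.

Lemma johnson_relE A B : johnson_rel A B = (#|blk A :&: blk B| == r.-1).
Proof. by []. Qed.

Lemma exists_blk (S : {set 'I_m}) : #|S| = r -> exists A : V, blk A = S.
Proof. by move/eqP => h; exists (exist _ S h). Qed.

Lemma card_blkI_eq A B : (#|blk A :&: blk B| == r) = (A == B).
Proof.
apply/eqP/eqP => [h|->]; last by rewrite setIid card_blk.
apply/val_inj/eqP; rewrite eqEcard !card_blk leqnn andbT.
by apply/setIidPl/eqP; rewrite eqEcard subsetIl h card_blk /=.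
Qed.

Lemma card_blkI_le A B : (#|blk A :&: blk B| <= r)%N.
Proof. by have := subset_leq_card (subsetIl (blk A) (blk B)); rewrite card_blk. Qed.

Definition jdist A B : nat := r - #|blk A :&: blk B|.

Lemma jdist0 A B : (jdist A B == 0)%N = (A == B).
Proof. by rewrite -card_blkI_eq; have := card_blkI_le A B; rewrite /jdist; lia. Qed.

Lemma jdist1 A B (hr : (1 <= r)%N) : (jdist A B == 1)%N = johnson_rel A B.
Proof. by rewrite johnson_relE; have := card_blkI_le A B; rewrite /jdist; move: hr; lia. Qed.

(** A step from [A] to [C] brings in a single new point, so the intersection with [B] grows by at
    most one per step. *)
Lemma walkb_jdist k A B (hr : (1 <= r)%N) :
  walkb (@johnson_rel m r) k A B -> (jdist A B <= k)%N.
Proof.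
elim: k A => [|k IH] A; first by rewrite walkb0 -jdist0 => /eqP ->.
rewrite walkbS => /existsP [C /andP [AC /IH CB]].
suff : (#|blk C :&: blk B| <= #|blk A :&: blk B| + 1)%N.
  by move: CB; rewrite /jdist; lia.
have sub : blk C :&: blk B \subset (blk A :&: blk B) :|: (blk C :\: blk A).
  by apply/subsetP => z; rewrite !inE => /andP [-> ->]; case: (z \in blk A).
have := leq_trans (subset_leq_card sub) (leq_card_setU _ _).
have := cardsID (blk A) (blk C); rewrite setIC card_blk (eqP AC).
by move: hr; lia.
Qed.

Lemma walkb_johnson A B : walkb (@johnson_rel m r) (jdist A B) A B.
Proof.
move E: (jdist A B) => k; elim: k A E => [|k IH] A E.
  by rewrite walkb0 -jdist0 E.
have cAB := cardsID (blk B) (blk A); have cBA := cardsID (blk A) (blk B).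
rewrite card_blk setIC in cBA; rewrite card_blk in cAB.
have /card_gt0P [x] : (0 < #|blk B :\: blk A|)%N.
  by move: E; rewrite /jdist; lia.
rewrite inE => /andP [xA xB].
have /card_gt0P [y] : (0 < #|blk A :\: blk B|)%N.
  by move: E; rewrite /jdist; lia.
rewrite inE => /andP [yB yA].
(* Exchanging [y] in [A] but not [B] for [x] in [B] but not [A] lowers [jdist] by exactly one. *)
have [|C CE] := exists_blk (x |: (blk A :\ y)).
  by have := cardsD1 y (blk A); rewrite cardsU1 !inE (negPf xA) andbF card_blk yA; lia.
rewrite walkbS; apply/existsP; exists C; apply/andP; split.
  rewrite johnson_relE.
  have -> : blk A :&: blk C = blk A :\ y; last first.
    by have := cardsD1 y (blk A); rewrite card_blk yA; lia.
  apply/setP => z; rewrite CE !inE.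
  case: (eqVneq z x) => [->|_] /=; first by rewrite (negPf xA) andbF.
  by case: (z \in blk A); rewrite ?andbF ?andbT.
apply: IH; rewrite /jdist.
have -> : blk C :&: blk B = x |: (blk A :&: blk B).
  apply/setP => z; rewrite CE !inE.
  case: (eqVneq z x) => [->|_] /=; first by rewrite xB.
  by case: (eqVneq z y) => [->|_] //=; rewrite (negPf yB) andbF.
by rewrite cardsU1 !inE (negPf xA) /= add1n subnS; move: E; rewrite /jdist => ->.
Qed.

(** A common neighbour is [z |: P] with [P] an [r.-1]-subset of both blocks and [z] outside their
    union; such a [z] exists because the union has at most [r + 1 < m] points. *)
Lemma walkb2_johnson A B (hr : (1 <= r)%N) (hm2r : (2 * r <= m)%N) (hm : (3 <= m)%N) :
  (jdist A B <= 1)%N -> walkb (@johnson_rel m r) 2 A B.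
Proof.
move=> AB.
suff [C AC CB] : exists2 C, johnson_rel A C & johnson_rel C B.
  by rewrite walkbS; apply/existsP; exists C; rewrite walkb1 AC.
have [P [PA PB cP]] : exists P : {set 'I_m}, [/\ P \subset blk A, P \subset blk B & #|P| = r.-1].
  have [->|AB0] := eqVneq A B.
    have /card_gt0P [a aB] : (0 < #|blk B|)%N by rewrite card_blk.
    exists (blk B :\ a); split; rewrite ?subD1set //.
    by have := cardsD1 a (blk B); rewrite card_blk aB; lia.
  exists (blk A :&: blk B); rewrite subsetIl subsetIr; split=> //; apply/eqP.
  by move: AB0; rewrite -jdist0 -johnson_relE -jdist1 //; move: AB; lia.
have [z] : exists z, z \in ~: (blk A :|: blk B).
  apply/card_gt0P; have := cardsC (blk A :|: blk B); rewrite card_ord.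
  have := cardsUI (blk A) (blk B); rewrite !card_blk.
  by move: AB; rewrite /jdist; move: hr hm2r hm; lia.
rewrite !inE negb_or => /andP [zA zB].
have PzE (D : V) : P \subset blk D -> z \notin blk D -> (z |: P) :&: blk D = P.
  move=> PD zD; apply/setP => t; rewrite !inE.
  case: (eqVneq t z) => [->|_] /=.
    by rewrite (negPf zD); apply/esym/negbTE; apply: contra zD; apply: (subsetP PD).
  by apply/andP/idP => [[] //|tP]; rewrite tP (subsetP PD).
have [|C CE] := exists_blk (z |: P).
  rewrite cardsU1 cP (contra (subsetP PA z) zA) /=; move: hr; lia.
exists C; rewrite johnson_relE ?(setIC (blk A)) CE PzE ?cP //.
Qed.

(** Since K_n has walks of every length at least 2, the length [jdist A B] works except when it is 0
    with [x != y] or 1 with [x = y]. In both exceptions length 2 is the least possible. *)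
Lemma gdist_kron_johnson (n : nat) (x y : 'I_n) A B
    (hn : (3 <= n)%N) (hr : (1 <= r)%N) (hm2r : (2 * r <= m)%N) (hm : (3 <= m)%N) :
  gdist (kron_rel (@complete_rel n) (@johnson_rel m r)) (x, A) (y, B) =
  (jdist A B + ((x == y) && johnson_rel A B) + 2 * ((x != y) && (A == B)))%N.
Proof.
rewrite -jdist1 // -jdist0.
set k := (X in _ = X).
have kE : k = (jdist A B + ((x == y) && (jdist A B == 1)%N) +
              2 * ((x != y) && (jdist A B == 0)%N))%N by [].
have k1 : (k = 1)%N -> x != y /\ jdist A B = 1%N.
  by rewrite kE; case: (x == y) => /=; case: (jdist A B) => [|[|j]] //=; lia.
have k0 : (k = 0)%N -> x = y /\ jdist A B = 0%N.
  by rewrite kE; case: (x =P y) => /= [->|_]; case: (jdist A B) => [|[|j]] //=; lia.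
apply: gdist_shortest => [|j jk].
  rewrite walkb_kron /=; case Ek: k => [|[|k']].
  - have [-> d0] := k0 Ek.
    by rewrite !walkb0 eqxx -jdist0 d0.
  - have [xy d1] := k1 Ek.
    by rewrite !walkb1 -jdist1 // d1 eqxx andbT.
  rewrite walkb_complete //=.
  case: (leqP (jdist A B) 1) => d.
    suff -> : k'.+2 = 2%N by apply: walkb2_johnson.
    by move: Ek; rewrite kE; case: (x == y) => /=; move: d; case: (jdist A B) => [|[|]] //=; lia.
  suff <- : jdist A B = k'.+2 by apply: walkb_johnson.
  by rewrite -Ek kE; move: d; case: (jdist A B) => [|[|]] //= *; rewrite !andbF; lia.
rewrite walkb_kron /=; apply/negP => /andP [wx wA].
have dj := walkb_jdist _ _ _ hr wA.
move: jk; rewrite kE; case: j dj wx wA => [|[|j]] dj.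
- rewrite !walkb0 -jdist0 => -> /eqP ->; by [].
- rewrite !walkb1 -jdist1 // => + /eqP ->.
  by rewrite /complete_rel => xy; rewrite xy (negPf xy).
by move=> _ _; case: (jdist A B) dj => [|[|d]] //=; case: (x == y) => /=; lia.
Qed.

End Johnson.

(** * Eigenvalues of a matrix that is triangular for a filtration of functionals *)

Local Open Scope ring_scope.

(* If a is a diagonal entry but not an eigenvalue, then the matrix minus a acts
   invertibly on the stable space annihilated by the functionals below [i], yet maps
   it into the kernel of [w i]. *)
Lemma filtered_eigenvalue {F : fieldType} {T I : finType} (g : T -> T -> F)
    (w : I -> T -> F) (rho : I -> nat) (nu : I -> F) (a : F) :
  (forall f : T -> F, (forall i, \sum_t f t * w i t = 0) -> forall t, f t = 0) ->
  (forall i (f : T -> F),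
     (forall j, (rho j < rho i)%N -> \sum_t f t * w j t = 0) ->
     \sum_u f u * (\sum_t g u t * w i t) = nu i * \sum_u f u * w i u) ->
  eigenvalue (\matrix_(i, j) g (enum_val i) (enum_val j) : 'M_#|T|) a <->
  exists i (f : T -> F), [/\ a = nu i,
     forall j, (rho j < rho i)%N -> \sum_t f t * w j t = 0
   & \sum_t f t * w i t != 0].
Proof.
move=> sep tri.
set M := \matrix_(i, j) _.
pose fn (v : 'rV[F]_#|T|) (t : T) := v 0 (enum_rank t).
pose col i : 'cV[F]_#|T| := \col_t w i (enum_val t).
have pairE v i : \sum_t fn v t * w i t = (v *m col i) 0 0.
  rewrite mxE (reindex _ (onW_bij _ (enum_val_bij T))) /=.
  by apply: eq_bigr => k _; rewrite mxE /fn enum_valK.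
have pairM v i : \sum_u fn v u * (\sum_t g u t * w i t) = (v *m M *m col i) 0 0.
  rewrite -mulmxA mxE (reindex _ (onW_bij _ (enum_val_bij T))) /=.
  apply: eq_bigr => k _; rewrite /fn enum_valK; congr (_ * _).
  rewrite mxE (reindex _ (onW_bij _ (enum_val_bij T))) /=.
  by apply: eq_bigr => l _; rewrite !mxE.
split=> [/eigenvalueP [v vM v0] | [i [f [-> flow fi]]]].
  have [i iP]: exists i, \sum_t fn v t * w i t != 0.
    apply/existsP; apply: contraNT v0 => /existsPn H; apply/eqP/rowP => k.
    rewrite mxE -[k]enum_valK; apply: (sep (fn v)) => i.
    by apply/eqP/negbNE/H.
  (* A functional of least rank among those not killing the eigenvector reads off its eigenvalue. *)
  have [j jP jmin] := @arg_minnP _ i (fun i => \sum_t fn v t * w i t != 0) rho iP.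
  have low k : (rho k < rho j)%N -> \sum_t fn v t * w k t = 0.
    by rewrite ltnNge => kj; apply/eqP; apply: contraNT kj => /jmin.
  exists j, (fn v); split=> //.
  have := tri j (fn v) low; rewrite pairM vM pairE -scalemxAl mxE => /eqP.
  rewrite -subr_eq0 -mulrBl mulf_eq0 -pairE (negPf jP) orbF subr_eq0.
  by move/eqP.
(* The left kernel of [Phi] is the space annihilated by all functionals of rank below that of
   [i]. *)
pose Phi : 'M[F]_(#|T|, #|I|) :=
  \matrix_(t, k) (if (rho (enum_val k) < rho i)%N then w (enum_val k) (enum_val t) else 0).
have lowP (v : 'rV_#|T|) : v *m Phi = 0 <->
    (forall j, (rho j < rho i)%N -> \sum_t fn v t * w j t = 0).
  have E k : (v *m Phi) 0 k = if (rho (enum_val k) < rho i)%N then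
       \sum_t fn v t * w (enum_val k) t else 0.
    rewrite mxE; case: ifP => kl; last first.
      by apply: big1 => t _; rewrite mxE kl mulr0.
    by rewrite pairE mxE; apply: eq_bigr => t _; rewrite !mxE kl.
  split=> [v0 j ji | H].
    by have := E (enum_rank j); rewrite v0 mxE enum_rankK ji.
  by apply/rowP => k; rewrite E mxE; case: ifP => // /H.
pose S := M - (nu i)%:M.
have KS (u : 'rV_#|T|) : u *m Phi = 0 -> u *m S *m Phi = 0 /\ u *m S *m col i = 0.
  move=> u0; have ulow := (lowP u).1 u0; split.
    apply: (lowP _).2 => j ji.
    rewrite pairE mulmxBr mulmxBl mul_mx_scalar -scalemxAl.
    have uj := ulow j ji.
    have trij : \sum_v fn u v * (\sum_t g v t * w j t) = 0.
      rewrite tri ?uj ?mulr0 // => k kj.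
      by apply: ulow; apply: ltn_trans ji.
    rewrite pairM in trij; rewrite pairE in uj.
    by rewrite mxE trij 2!mxE uj mulr0 subr0.
  apply/rowP => k; rewrite ord1 mulmxBr mulmxBl mul_mx_scalar -scalemxAl.
  have := tri i (fn u) ulow; rewrite pairM pairE => trii.
  by move: (u *m col i) (u *m M *m col i) trii => X Y trii; rewrite !mxE trii subrr.
case: (boolP (eigenvalue M (nu i))) => // noeig; exfalso.
have Sfree : row_free S.
  by rewrite -kermx_eq0; move: noeig; rewrite /eigenvalue /eigenspace negbK.
pose K := kermx Phi.
have KSK : (K *m S <= K)%MS.
  apply/sub_kermxP/row_matrixP => k; rewrite 2!row_mul row0.
  have [|-> //] := KS (row k K); rewrite -row_mul.
  by rewrite (sub_kermxP (submx_refl _)) row0.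
(* [S] is injective and keeps [K] stable, so it maps [K] onto itself; thus [f] lies in the image of
   [K], which [w i] kills. *)
have /eqmxP KE : (K *m S == K)%MS.
  by rewrite -(mxrank_leqif_eq KSK).2 mxrankMfree.
pose v : 'rV_#|T| := \row_k f (enum_val k).
have fv t : fn v t = f t by rewrite /fn mxE enum_rankK.
have vK : (v <= K *m S)%MS.
  rewrite KE; apply/sub_kermxP; apply: (lowP _).2 => j ji.
  by apply: etrans (flow j ji); apply: eq_bigr => t _; rewrite fv.
have /submxP [u vE] := vK.
case/negP: fi; apply/eqP.
transitivity (\sum_t fn v t * w i t); first by apply: eq_bigr => t _; rewrite fv.
rewrite pairE vE mulmxA (KS (u *m K) _).2 ?mxE //.
by rewrite -mulmxA (sub_kermxP (submx_refl _)) mulmx0.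
Qed.

(** * Action of the Johnson adjacency and distance matrices on subset indicators *)

Section JohnsonSpectrum.
Context {m r : nat}.
Notation V := (johnson_V m r).
Implicit Types (A B C : V) (S : {set 'I_m}).

(* The neighbours of B are the sets x |: (B :\ y) with y in B and x outside B. *)
Lemma card_swap_supersets B S (hr : (1 <= r)%N) :
  #|[set A : {set 'I_m} | [&& #|A| == r, #|blk B :&: A| == r.-1 & S \subset A]]| =
  (#|blk B :\: S| * #|[set x in ~: blk B | S :\ x \subset blk B]|)%N.
Proof.
set b := blk B; have cb : #|b| = r by apply: card_blk.
pose h (p : 'I_m * 'I_m) : {set 'I_m} := p.2 |: (b :\ p.1).
have hP (y x : 'I_m) : y \in b -> x \notin b -> #|h (y, x)| = r /\ #|b :&: h (y, x)| = r.-1.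
  move=> yb xb; have := cardsD1 y b; rewrite yb cb /h /= => cby; split.
    by rewrite cardsU1 !inE (negPf xb) andbF cby.
  rewrite cby; congr #|pred_of_set _|.
  apply/setP => z; rewrite !inE /=; case: (eqVneq z x) => [->|_] /=.
    by rewrite (negPf xb) andbF.
  by case: (z \in b); rewrite ?andbF ?andbT.
rewrite -cardsX.
have <- : h @: setX (b :\: S) [set x in ~: b | S :\ x \subset b] =
    [set A : {set 'I_m} | [&& #|A| == r, #|b :&: A| == r.-1 & S \subset A]].
  apply/setP => A; rewrite inE; apply/imsetP/and3P.
    case=> -[y x]; rewrite !inE /= => /andP [/andP [yS yb] /andP [xb Sx]] ->.
    have [-> ->] := hP y x yb xb; rewrite !eqxx; split=> //.
    apply/subsetP => z zS; rewrite !inE /=; case: (eqVneq z x) => //= zx.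
    rewrite (subsetP Sx) ?inE ?zx // andbT.
    by apply: contraNneq yS => <-.
  case=> /eqP cA /eqP cAb SA.
  have cAD := cardsID b A; rewrite setIC cAb cA in cAD.
  have cbD := cardsID A b; rewrite cAb cb in cbD.
  have /cards1P [x xE] : #|A :\: b| == 1%N by lia.
  have /cards1P [y yE] : #|b :\: A| == 1%N by lia.
  have inA z : (z \in A) && (z \notin b) = (z == x).
    by have /setP /(_ z) := xE; rewrite !inE andbC.
  have inb z : (z \in b) && (z \notin A) = (z == y).
    by have /setP /(_ z) := yE; rewrite !inE andbC.
  have /andP [xA xb] : (x \in A) && (x \notin b) by rewrite inA.
  have /andP [yb yA] : (y \in b) && (y \notin A) by rewrite inb.
  exists (y, x).
    rewrite !inE /= yb xb andbT (contra (subsetP SA y) yA) /=.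
    apply/subsetP => z; rewrite !inE -inA negb_and negbK => /andP [+ /(subsetP SA) zA].
    by rewrite zA.
  apply/setP => z; rewrite !inE /= -inA -inb.
  by case: (z \in A); case: (z \in b).
(* The swap is injective: [x] is the only point of the image outside [B], and [y] the only point of
   [B] missing from it. *)
rewrite card_in_imset // => -[y x] [y' x']; rewrite !inE /=.
move=> /andP [/andP [yS yb] /andP [xb Sx]] /andP [/andP [yS' yb'] /andP [xb' Sx']] /setP hE.
have xx : x = x'.
  by have := hE x; rewrite !inE /= eqxx (negPf xb) !andbF !orbF => /esym /eqP.
have yx : y == x' = false by apply: contraNF xb' => /eqP <-.
have := hE y; rewrite !inE /= eqxx yb xx yx /= andbT => /esym /negbFE /eqP ->.
by [].
Qed.

Context {R : realFieldType}.

Lemma sum_blk (F : {set 'I_m} -> R) :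
  \sum_(A : V) F (blk A) = \sum_(A : {set 'I_m} | #|A| == r) F A.
Proof. by rewrite -(big_sub (op := +%R) (fun A : {set 'I_m} => #|A| == r)). Qed.

(** With k = |S|: if [S] lies in [B], there are (r-k)(m-r) swaps keeping [S], which splits as
    (r-k)(m-r-k) - k plus (r+1-k)k. Otherwise a swap can only help by inserting the unique point of
    [S] missing from [B], leaving r+1-k points to remove. *)
Lemma sum_johnson_rel B S (hr : (1 <= r)%N) (hm2r : (2 * r <= m)%N) :
  \sum_(A : V) (johnson_rel B A)%:R * (S \subset blk A)%:R =
  (((r - #|S|) * (m - r - #|S|))%:R - #|S|%:R) * (S \subset blk B)%:R +
  (r.+1 - #|S|)%:R * \sum_(x in S) (S :\ x \subset blk B)%:R :> R.
Proof.
have -> : \sum_(A : V) (johnson_rel B A)%:R * (S \subset blk A)%:R =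
    (#|blk B :\: S| * #|[set x in ~: blk B | S :\ x \subset blk B]|)%:R :> R.
  rewrite -card_swap_supersets // -sum1_card natr_sum.
  pose F (X : {set 'I_m}) : R := ((#|blk B :&: X| == r.-1) && (S \subset X))%:R.
  transitivity (\sum_(A : V) F (blk A)).
    by apply: eq_bigr => A _; rewrite johnson_relE -natrM mulnb.
  rewrite (sum_blk F).
  rewrite big_mkcond [RHS]big_mkcond /=; apply: eq_bigr => X _.
  by rewrite inE /F; case: (#|X| == r) => //=; case: (_ && _).
have cDS := cardsID S (blk B); rewrite card_blk in cDS.
have [SB|SB] := boolP (S \subset blk B).
  have Sx x : S :\ x \subset blk B by apply: subset_trans SB; apply: subD1set.
  have -> : [set x in ~: blk B | S :\ x \subset blk B] = ~: blk B.
    by apply/setP => x; rewrite !inE Sx andbT.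
  have cC := cardsC (blk B); rewrite card_blk card_ord in cC.
  rewrite (eq_bigr (fun=> 1)) => [|x _]; last by rewrite Sx.
  rewrite sumr_const mulr1.
  have Sr : (#|S| <= r)%N by have := subset_leq_card SB; rewrite card_blk.
  have -> : #|~: blk B| = (m - r)%N by rewrite -[in RHS]cC addKn.
  have -> : #|blk B :\: S| = (r - #|S|)%N.
    by rewrite (setIidPr SB) in cDS; rewrite -[in RHS]cDS addKn.
  move: #|S| Sr => k kr.
  have [p rE] : exists p, r = (k + p)%N by exists (r - k)%N; lia.
  have [q mE] : exists q, m = (r + k + q)%N by exists (m - r - k)%N; lia.
  have -> : (r - k = p)%N by lia.
  have -> : (m - r - k = q)%N by lia.
  have -> : (m - r = k + q)%N by lia.
  have -> : (r.+1 - k = p.+1)%N by lia.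
  by rewrite !natrM natrD -addn1 natrD; ring.
rewrite mulr0 add0r.
have -> : \sum_(x in S) (S :\ x \subset blk B)%:R =
    #|[set x in ~: blk B | S :\ x \subset blk B]|%:R :> R.
  rewrite -sum1_card natr_sum big_mkcond [RHS]big_mkcond /=; apply: eq_bigr => x _.
  rewrite !inE; have [Sx|] := boolP (S :\ x \subset blk B); last by rewrite andbF if_same.
  have -> : (x \in S) = (x \notin blk B); last by rewrite andbT.
  apply/idP/idP => [xS|xB]; apply: contraR SB.
    by rewrite negbK => xB; rewrite -(setD1K xS) subUset sub1set xB.
  by move=> xS; move: Sx; rewrite (setDidPl _) // disjoint_sym disjoints1.
rewrite natrM; have [->|[x]] := set_0Vmem [set x in ~: blk B | S :\ x \subset blk B].
  by rewrite cards0 !mulr0.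
rewrite !inE => /andP [xB Sx]; congr (_%:R * _).
have xS : x \in S.
  apply: contraR SB => xS; move: Sx.
  by rewrite (setDidPl _) // disjoint_sym disjoints1.
have BSE : blk B :&: S = S :\ x.
  apply/setP => z; rewrite !inE; have := subsetP Sx z; rewrite !inE.
  case: (eqVneq z x) => [->|_] /=; first by rewrite (negPf xB).
  by case: (z \in S) => [->|] //; rewrite andbF.
have := cardsD1 x S; rewrite xS; rewrite BSE in cDS; lia.
Qed.

(** Taking complements gives the [(m - r)]-subsets of [~: S]. The lower index [m - r] keeps the
    count 0 when [#|S| > r], where truncated [r - #|S|] would give 1. *)
Lemma card_supersets S (rm : (r <= m)%N) :
  #|[set A : {set 'I_m} | #|A| == r & S \subset A]| = 'C(m - #|S|, m - r).
Proof.
have cC (X : {set 'I_m}) : #|~: X| = (m - #|X|)%N.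
  by rewrite [LHS]cardsCs setCK card_ord.
rewrite -(cC S) -cards_draws -(card_imset _ (can_inj (@setCK _))).
apply: eq_card => X; rewrite inE; apply/imsetP/andP.
  case=> Y; rewrite inE => /andP [/eqP cY SY] ->.
  by rewrite setCS cC cY.
case=> XS /eqP cX; exists (~: X); last by rewrite setCK.
rewrite inE -setCS setCK XS andbT cC cX; lia.
Qed.

Lemma sum_superset S (rm : (r <= m)%N) :
  \sum_(A : V) (S \subset blk A)%:R = 'C(m - #|S|, m - r)%:R :> R.
Proof.
rewrite (sum_blk (fun X => (S \subset X)%:R)) -card_supersets // -sum1_card natr_sum.
rewrite big_mkcond [RHS]big_mkcond /=; apply: eq_bigr => X _; rewrite inE.
by case: (#|X| == r) => //=; case: (_ \subset _).
Qed.

Lemma sum_jdist B S (rm : (r <= m)%N) :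
  \sum_(A : V) (jdist B A)%:R * (S \subset blk A)%:R =
  r%:R * 'C(m - #|S|, m - r)%:R -
  \sum_(y in blk B) 'C(m - #|y |: S|, m - r)%:R :> R.
Proof.
rewrite -sum_superset // mulr_sumr.
rewrite [X in _ - X](eq_bigr _ (fun y _ => esym (sum_superset _ rm))).
rewrite exchange_big -sumrB; apply: eq_bigr => A _ /=.
rewrite /jdist natrB ?card_blkI_le // mulrBl; congr (_ - _).
rewrite -sum1_card natr_sum mulr_suml big_mkcond [RHS]big_mkcond /=.
apply: eq_bigr => y _; rewrite inE subUset sub1set.
by case: (y \in blk B) => //=; case: (y \in blk A); rewrite ?mul1r ?mul0r.
Qed.

(** Absorption, j C(r,j) = r C(r-1,j-1), and the symmetry of C(m-r,j) bring the sum to Vandermonde's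
    form. *)
Lemma sum_distance (hr : (1 <= r)%N) (hm2r : (2 * r <= m)%N) :
  (\sum_(j < r.+1) j * 'C(r, j) * 'C(m - r, j) = r * 'C(m.-1, (m - r).-1))%N.
Proof.
rewrite big_ord_recl mul0n add0n.
have -> : (m.-1 = r.-1 + (m - r))%N by lia.
rewrite -binomial.Vandermonde big_distrr /= prednK; last by lia.
(* Vandermonde's sum has [m - r] terms, at least [r]; the additional ones vanish. *)
rewrite (big_ord_widen (m - r) (fun j => j.+1 * 'C(r, j.+1) * 'C(m - r, j.+1))%N); last by lia.
rewrite big_mkcond; apply: eq_bigr => i _ /=.
have im := ltn_ord i.
rewrite mulnA mul_bin_diag -(bin_sub im).
have -> : ((m - r).-1 - i = m - r - i.+1)%N by lia.
case: ltnP => // ri.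
by rewrite (bin_small (n := r)) // muln0.
Qed.

Definition johnson_ev (k : nat) : R := ((r - k) * (m - r - k))%:R - k%:R.

(** Indexed by filtration level, so that it pairs with [johnson_ev] at the same level. *)
Definition johnson_dist_ev (k : nat) : R :=
  let s := (\sum_(j < r.+1) j * 'C(r, j) * 'C(m - r, j))%N in
  match k with 0 => s%:R | 1 => - (s%:R / (m%:R - 1)) | _ => 0 end.

(** The correction terms of [sum_johnson_rel] involve only the smaller sets [S :\ x], which [h]
    annihilates. *)
Lemma pair_johnson_rel (h : V -> R) S (hr : (1 <= r)%N) (hm2r : (2 * r <= m)%N) :
  (forall S' : {set 'I_m}, (#|S'| < #|S|)%N -> \sum_B h B * (S' \subset blk B)%:R = 0) ->
  \sum_B h B * (\sum_A (johnson_rel B A)%:R * (S \subset blk A)%:R) =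
  johnson_ev #|S| * \sum_B h B * (S \subset blk B)%:R.
Proof.
move=> low; rewrite mulr_sumr.
under eq_bigr do rewrite sum_johnson_rel // mulrDr.
rewrite big_split /= [X in _ + X](_ : _ = 0) ?addr0; last first.
  under eq_bigr do rewrite mulrCA !mulr_sumr.
  rewrite exchange_big big1 //= => x xS.
  rewrite -mulr_sumr low ?mulr0 //.
  by rewrite [X in (_ < X)%N](cardsD1 x) xS.
by apply: eq_bigr => B _; rewrite mulrCA.
Qed.

Lemma pair_jdist (h : V -> R) S (hr : (1 <= r)%N) (hm2r : (2 * r <= m)%N) (hm : (3 <= m)%N) :
  (forall S' : {set 'I_m}, (#|S'| < #|S|)%N -> \sum_B h B * (S' \subset blk B)%:R = 0) ->
  \sum_B h B * (\sum_A (jdist B A)%:R * (S \subset blk A)%:R) =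
  johnson_dist_ev #|S| * \sum_B h B * (S \subset blk B)%:R.
Proof.
have rm : (r <= m)%N by lia.
move=> low; rewrite /johnson_dist_ev sum_distance //.
pose P S' := \sum_B h B * (S' \subset blk B)%:R.
have PE S' : \sum_B h B * (S' \subset blk B)%:R = P S' by [].
have P0 c : \sum_B h B * c = c * P set0.
  by rewrite mulr_sumr; apply: eq_bigr => B _; rewrite sub0set mulr1 mulrC.
have sumP (c : 'I_m -> R) : \sum_B h B * (\sum_(y in blk B) c y) = \sum_y c y * P [set y].
  under eq_bigr do rewrite big_mkcond mulr_sumr.
  rewrite exchange_big; apply: eq_bigr => y _ /=.
  rewrite mulr_sumr; apply: eq_bigr => B _; rewrite sub1set.
  by case: (y \in blk B); rewrite ?mulr0 ?mulr1 // mulrC.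
under eq_bigr do rewrite sum_jdist // mulrBr.
rewrite sumrB P0 sumP PE.
(* Double counting: every block has [r] points. *)
have sumP1 : \sum_y P [set y] = r%:R * P set0.
  rewrite -P0 -[LHS](eq_bigr _ (fun y _ => mul1r _)) -sumP.
  by apply: eq_bigr => B _; rewrite sumr_const card_blk.
have [q mE] : exists q, (m = r + q.+1)%N by exists (m - r).-1; lia.
have mr : (m - r = q.+1)%N by lia.
have [S0|Sn0] := eqVneq #|S| 0%N.
  have -> : S = set0 by apply/eqP; rewrite -cards_eq0 S0.
  rewrite cards0; under eq_bigr do rewrite setU0 cards1.
  rewrite -mulr_sumr sumP1 mr subn0 subn1.
  have -> : ('C(m, q.+1) = 'C(m.-1, q.+1) + 'C(m.-1, q))%N.
    by rewrite -binS prednK //; lia.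
  by rewrite natrD natrM; ring.
have P00 : P set0 = 0 by apply: low; rewrite cards0; lia.
rewrite P00 mulr0 sub0r.
have [S1|Sn1] := eqVneq #|S| 1%N.
  have /eqP/cards1P [x ->] := S1; rewrite cards1.
  have yE y : (#|y |: [set x]|)%N = (y != x).+1 by rewrite cards2.
  under eq_bigr do rewrite yE.
  rewrite (bigD1 x) //= eqxx subn1 mr.
  under eq_bigr => y yx do rewrite yx subn2.
  rewrite -mulr_sumr.
  have -> : \sum_(y | y != x) P [set y] = - P [set x].
    by apply/eqP; move: sumP1; rewrite (bigD1 x) //= P00 mulr0 addrC => /eqP; rewrite addr_eq0.
  have [p mp] : exists p, (m = p.+2)%N by exists (m - 2)%N; lia.
  (* Hence s/(m-1) is ['C(m.-2, q)], the Pascal difference between the coefficients for [y = x] and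
     [y != x]. *)
  have -> : (r * 'C(m.-1, q) = m.-1 * 'C(m.-2, q))%N.
    by rewrite mul_bin_down; congr (_ * _)%N; lia.
  move: (P [set x]) => c; rewrite mp /= binS -natr1 natrM -natr1.
  have p1 : p%:R + 1 != 0 :> R by rewrite natr1 pnatr_eq0.
  by rewrite addrK natrD; field.
have Py y : P [set y] = 0 by apply: low; rewrite cards1; lia.
rewrite [X in - X]big1; last by move=> y _; rewrite Py mulr0.
by rewrite oppr0; case: #|S| Sn0 Sn1 => [|[|k]] //; rewrite mul0r.
Qed.

End JohnsonSpectrum.

(** * Functions that attain each level of the Johnson filtration *)

Lemma exists_harmonic {R : realFieldType} {m r : nat} (k : nat) :
  (2 * r <= m)%N -> (k <= r)%N ->
  exists2 f : johnson_V m r -> R,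
    forall S : {set 'I_m}, (#|S| < k)%N -> \sum_A f A * (S \subset blk A)%:R = 0
  & exists2 S : {set 'I_m}, #|S| = k & \sum_A f A * (S \subset blk A)%:R != 0.
Proof.
move=> hm2r kr.
have km : (k <= m)%N by lia.
have hb (i : 'I_k) : (r + i < m)%N by have := ltn_ord i; lia.
(* The pairs are (i, r+i) for i < k: disjoint since [k <= r], and within range since
   [2 * r <= m]. *)
pose a (i : 'I_k) : 'I_m := widen_ord km i.
pose b (i : 'I_k) : 'I_m := Ordinal (hb i).
have a_inj : injective a by move=> i j /(congr1 val) /= ij; apply: val_inj.
have b_inj : injective b by move=> i j /(congr1 val) /= /addnI ij; apply: val_inj.
have ab i j : a i != b j.
  by rewrite -val_eqE /=; have := ltn_ord i; lia.
pose F (X : {set 'I_m}) : R := \prod_i ((a i \in X)%:R - (b i \in X)%:R).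
exists (fun A => F (blk A)) => [S Sk|].
  rewrite (sum_blk (fun X => F X * (S \subset X)%:R)).
  (* S misses some pair {a i, b i}; swapping its two points changes the sign of F. *)
  have [i [aS bS]] : exists i, a i \notin S /\ b i \notin S.
    have [/existsP [i /andP []]|/existsPn H] :=
      boolP [exists i, (a i \notin S) && (b i \notin S)]; first by exists i.
    (* If [S] met every pair, choosing one point from each would embed [k] points in [S]. *)
    pose c i := if a i \in S then a i else b i.
    have c_inj : injective c.
      move=> i j; rewrite /c; case: ifP => _; case: ifP => _.
      - exact: a_inj.
      - by move/eqP; rewrite (negPf (ab _ _)).
      - by move/esym/eqP; rewrite (negPf (ab _ _)).
      exact: b_inj.
    have : [set c i | i : 'I_k] \subset S.
      apply/subsetP => _ /imsetP [i _ ->]; rewrite /c; case: ifP => // aS.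
      by have := H i; rewrite aS /= negbK.
    by move/subset_leq_card; rewrite card_imset // card_ord leqNgt Sk.
  pose t := tperm (a i) (b i).
  have tN (X : {set 'I_m}) : F (t @^-1: X) = - F X.
    rewrite /F (bigD1 i) //= [in RHS](bigD1 i) //= !inE tpermL tpermR.
    rewrite -mulNr opprB; congr (_ * _); apply: eq_bigr => j ji.
    have taj : t (a j) = a j by apply: tpermD; rewrite eq_sym ?ab // (inj_eq a_inj).
    have tbj : t (b j) = b j by apply: tpermD; rewrite ?ab // eq_sym (inj_eq b_inj).
    by rewrite !inE taj tbj.
  set s := LHS.
  suff : s = - s by lra.
  rewrite {1}/s.
  have t_inj : injective (fun X : {set 'I_m} => t @^-1: X).
    move=> X Y /setP XY; apply/setP => z.
    by have := XY (t z); rewrite !inE tpermK.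
  rewrite (reindex_inj t_inj) -sumrN; apply: eq_big => X.
    by rewrite card_preimset //; apply: perm_inj.
  move=> _; rewrite tN mulNr; congr (- (_ * _%:R)).
  have tS z : z \in S -> t z = z.
    by move=> zS; apply: tpermD; [apply: contraNneq aS | apply: contraNneq bS] => ->.
  congr nat_of_bool; apply/subsetP/subsetP => SX z zS.
    by have := SX z zS; rewrite inE tS.
  by rewrite inE tS // SX.
exists [set a i | i : 'I_k]; first by rewrite card_imset // card_ord.
set S := [set a i | i : 'I_k].
have aS i : a i \in S by apply: imset_f.
rewrite (sum_blk (fun X => F X * (S \subset X)%:R)).
have rm : (r <= m)%N by lia.
(* [A0] contains every [a i] and no [b i], so [F] is 1 there, while [F] is nonnegative on all sets
   containing [S]: the sum is positive. *)
pose A0 : {set 'I_m} := [set widen_ord rm i | i : 'I_r].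
have cA0 : #|A0| == r.
  rewrite card_imset ?card_ord // => i j /(congr1 val) /= ij; exact: val_inj.
have A0P (z : 'I_m) : (z \in A0) = (z < r)%N.
  apply/imsetP/idP => [[i _ ->]|zr]; first by apply: (ltn_ord i).
  by exists (Ordinal zr) => //; apply: val_inj.
have F0 (X : {set 'I_m}) : S \subset X -> 0 <= F X.
  move=> /subsetP SX; apply: prodr_ge0 => i _; rewrite SX // subr_ge0.
  by case: (b i \in X).
rewrite (bigD1 A0) //=.
have -> : F A0 * (S \subset A0)%:R = 1.
  have -> : S \subset A0.
    apply/subsetP => _ /imsetP [i _ ->]; rewrite A0P /=.
    exact: leq_trans (ltn_ord i) kr.
  rewrite mulr1 /F big1 // => i _; rewrite !A0P /=.
  by rewrite (leq_trans (ltn_ord i) kr) ltnNge leq_addr subr0.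
rewrite gt_eqF // ltr_pwDl // sumr_ge0 // => X _.
have [SX|_] := boolP (S \subset X); last by rewrite mulr0.
by rewrite mulr1 F0.
Qed.

(** * The filtration for the Kronecker product and its diagonal *)

Section Kronecker.
Context {R : realFieldType} {n m r : nat}.
Hypotheses (hn : (3 <= n)%N) (hr : (1 <= r)%N) (hm2r : (2 * r <= m)%N) (hm : (3 <= m)%N).
Notation V := (johnson_V m r).

Definition fibre_weight (o : option 'I_n) (y : 'I_n) : R :=
  if o is Some z then (y == z)%:R else 1.

Definition kron_weight (i : option 'I_n * {set 'I_m}) (t : 'I_n * V) : R :=
  fibre_weight i.1 t.1 * (i.2 \subset blk t.2)%:R.

(* The offset [m.+1] ranks every functional with a fixed first coordinate above
   all those that sum over it. *)
Definition kron_rank (i : option 'I_n * {set 'I_m}) : nat :=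
  #|i.2| + (if i.1 is Some _ then m.+1 else 0).

(** J contributes [n] on the constant function ([None]) and 0 on point indicators modulo constants
    ([Some]). *)
Definition kron_ev (i : option 'I_n * {set 'I_m}) : R :=
  johnson_ev (m := m) (r := r) #|i.2| +
  (if i.1 is Some _ then - 2
   else 2 * n%:R - 2 + n%:R * johnson_dist_ev (m := m) (r := r) #|i.2|).

Lemma sum_pair {I J : finType} (F : I * J -> R) : \sum_t F t = \sum_i \sum_j F (i, j).
Proof. by rewrite pair_bigA; apply: eq_bigr => -[]. Qed.

Lemma sum_fibre_weight o : \sum_y fibre_weight o y = if o is Some _ then 1 else n%:R.
Proof.
case: o => [z|] /=; last by rewrite sumr_const card_ord.
by rewrite (bigD1 z) //= eqxx big1 ?addr0 // => y /negPf ->.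
Qed.

Lemma pair_kron_weight (f : 'I_n * V -> R) o (S : {set 'I_m}) :
  \sum_t f t * kron_weight (o, S) t =
  \sum_B (\sum_x f (x, B) * fibre_weight o x) * (S \subset blk B)%:R.
Proof.
rewrite sum_pair exchange_big; apply: eq_bigr => B _.
by rewrite mulr_suml; apply: eq_bigr => x _; rewrite mulrA.
Qed.

Lemma sum_gdist_kron_weight o (S : {set 'I_m}) (x : 'I_n) (B : V) :
  \sum_t (gdist (kron_rel (@complete_rel n) (@johnson_rel m r)) (x, B) t)%:R
     * kron_weight (o, S) t =
  (\sum_y fibre_weight o y) * (\sum_A (jdist B A)%:R * (S \subset blk A)%:R) +
  fibre_weight o x * (\sum_A (johnson_rel B A)%:R * (S \subset blk A)%:R) +
  2 * ((\sum_y fibre_weight o y) - fibre_weight o x) * (S \subset blk B)%:R.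
Proof.
have BE : \sum_A (B == A)%:R * (S \subset blk A)%:R = (S \subset blk B)%:R :> R.
  rewrite (bigD1 B) //= eqxx mul1r big1 ?addr0 // => A AB.
  by rewrite eq_sym (negPf AB) mul0r.
have xE : \sum_y (x == y)%:R * fibre_weight o y = fibre_weight o x.
  rewrite (bigD1 x) //= eqxx mul1r big1 ?addr0 // => y yx.
  by rewrite eq_sym (negPf yx) mul0r.
have xnE : \sum_y (x != y)%:R * fibre_weight o y =
    \sum_y fibre_weight o y - fibre_weight o x.
  rewrite -[in RHS]xE -sumrB; apply: eq_bigr => y _.
  by case: (x == y); rewrite ?mul0r ?mul1r ?subrr ?subr0.
rewrite -mulrA -BE -xnE -{1}xE !mulr_suml mulr_sumr -!big_split sum_pair /=.
apply: eq_bigr => y _; rewrite !mulr_sumr -!big_split /=; apply: eq_bigr => A _.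
rewrite /kron_weight gdist_kron_johnson //=.
by rewrite 2!natrD natrM -!mulnb !natrM; ring.
Qed.

(** The only block containing [blk B] is [B], so the functional at [(Some z, blk B)] is evaluation
    at [(z, B)]. *)
Lemma kron_weight_separates (f : 'I_n * V -> R) :
  (forall i, \sum_t f t * kron_weight i t = 0) -> forall t, f t = 0.
Proof.
move=> f0 [z B]; rewrite -(f0 (Some z, blk B)) pair_kron_weight (bigD1 B) //=.
rewrite subxx mulr1 (bigD1 z) //= eqxx mulr1.
rewrite big1 ?addr0 => [|x /negPf ->]; last by rewrite mulr0.
rewrite big1 ?addr0 // => A AB.
have [BA|_] := boolP (blk B \subset blk A); last by rewrite mulr0.
case/eqP: AB; apply/esym/val_inj/eqP.
by rewrite eqEcard -/(blk B) -/(blk A) BA !card_blk leqnn.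
Qed.

Lemma kron_weight_triangular i (f : 'I_n * V -> R) :
  (forall j, (kron_rank j < kron_rank i)%N -> \sum_t f t * kron_weight j t = 0) ->
  \sum_u f u * (\sum_t (gdist (kron_rel (@complete_rel n) (@johnson_rel m r)) u t)%:R
     * kron_weight i t) = kron_ev i * \sum_u f u * kron_weight i u.
Proof.
case: i => o S low.
pose h o' B := \sum_x f (x, B) * fibre_weight o' x.
have hsum o' (q : V -> R) :
    \sum_B h o' B * q B = \sum_u f u * fibre_weight o' u.1 * q u.2.
  rewrite sum_pair exchange_big; apply: eq_bigr => B _ /=.
  by rewrite mulr_suml.
have hE o' (S' : {set 'I_m}) :
    \sum_B h o' B * (S' \subset blk B)%:R = \sum_t f t * kron_weight (o', S') t.
  by rewrite pair_kron_weight.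
have lowh (S' : {set 'I_m}) : (#|S'| < #|S|)%N -> \sum_B h o B * (S' \subset blk B)%:R = 0.
  by move=> SS; rewrite hE low // /kron_rank /= ltn_add2r.
have -> : \sum_u f u * (\sum_t (gdist (kron_rel (@complete_rel n) (@johnson_rel m r)) u t)%:R
     * kron_weight (o, S) t) =
   (\sum_y fibre_weight o y) *
      (\sum_B h None B * (\sum_A (jdist B A)%:R * (S \subset blk A)%:R)) +
   (\sum_B h o B * (\sum_A (johnson_rel B A)%:R * (S \subset blk A)%:R)) +
   2 * ((\sum_y fibre_weight o y) * (\sum_B h None B * (S \subset blk B)%:R) -
        \sum_B h o B * (S \subset blk B)%:R).
  rewrite !hsum; move: (\sum_y _) (sum_gdist_kron_weight o S) => C gE.
  rewrite !mulr_sumr -sumrB mulr_sumr -!big_split.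
  by apply: eq_bigr => -[x B] _; rewrite gE /=; ring.
rewrite pair_jdist // ?pair_johnson_rel // ?hE ?sum_fibre_weight; last first.
  case: o low lowh => [z|] low lowh // S' SS.
  by rewrite hE low // /kron_rank /= addn0 ltn_addr.
rewrite /kron_ev /=.
case: o low lowh => [z|] low lowh; last by ring.
(* J turns the indicator of [z] into the constant function, whose functional at the same [S] ranks
   lower and vanishes on [f]. *)
rewrite (low (None, S)) /kron_rank /=; last by rewrite ltn_add2l.
by ring.
Qed.

Lemma pair_pure (q : 'I_n -> R) (f : V -> R) o (S : {set 'I_m}) :
  \sum_t q t.1 * f t.2 * kron_weight (o, S) t =
  (\sum_y q y * fibre_weight o y) * \sum_A f A * (S \subset blk A)%:R.
Proof.
rewrite pair_kron_weight mulr_sumr; apply: eq_bigr => A _.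
rewrite mulrA; congr (_ * _); rewrite mulr_suml.
by apply: eq_bigr => y _ /=; ring.
Qed.

(** Tensor a function from [exists_harmonic] with the constant 1 for [None], or for [Some z] with a
    difference of two point indicators, which has sum 0 and so is killed by every [None]
    functional. *)
Lemma kron_ev_attained o (k : nat) : (k <= r)%N ->
  exists (i : option 'I_n * {set 'I_m}) (f : 'I_n * V -> R), [/\ i.1 = o, #|i.2| = k,
     forall j, (kron_rank j < kron_rank i)%N -> \sum_t f t * kron_weight j t = 0
   & \sum_t f t * kron_weight i t != 0].
Proof.
move=> kr; have [f flow [S Sk fS]] := exists_harmonic (R := R) k hm2r kr.
have lt_m (S' : {set 'I_m}) : (#|S'| <= m)%N.
  by have := max_card (mem S'); rewrite card_ord.
case: o => [z|]; last first.
  exists (None, S), (fun t => 1 * f t.2); split=> // [[o S']|].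
    case: o => [z|] /=; rewrite /kron_rank /= ?addn0.
      by rewrite ltnNge (leq_trans (lt_m S)) // addnS leqW // leq_addl.
    by move=> SS; rewrite (pair_pure (fun=> 1)) flow ?mulr0 // -Sk.
  rewrite (pair_pure (fun=> 1)) mulf_neq0 //.
  under eq_bigr do rewrite mul1r.
  rewrite sum_fibre_weight pnatr_eq0; lia.
have [z' zz'] : exists z', z' != z.
  have : (0 < #|predC1 z|)%N by rewrite cardC1 card_ord; lia.
  by case/card_gt0P => z'; rewrite inE => ?; exists z'.
pose q y : R := (y == z)%:R - (y == z')%:R.
exists (Some z, S), (fun t => q t.1 * f t.2); split=> // [[o S']|].
  rewrite pair_pure /kron_rank /=; case: o => [y|] /=.
    by rewrite ltn_add2r Sk => /flow ->; rewrite mulr0.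
  move=> _; under eq_bigr do rewrite mulr1.
  rewrite sumrB.
  have E (y : 'I_n) : \sum_x (x == y)%:R = 1 :> R by apply: (sum_fibre_weight (Some y)).
  by rewrite !E subrr mul0r.
rewrite pair_pure mulf_neq0 // (bigD1 z) //= big1 => [|y /negPf ->]; last by rewrite mulr0.
by rewrite /q eqxx [z == z']eq_sym (negPf zz') subr0 mulr1 addr0 oner_neq0.
Qed.

Lemma kron_weight_eq0 o (S : {set 'I_m}) t : (r < #|S|)%N -> kron_weight (o, S) t = 0.
Proof.
case: t => y A rS; rewrite /kron_weight /=.
have [/subset_leq_card|_] := boolP (S \subset blk A); last by rewrite mulr0.
by rewrite card_blk leqNgt rS.
Qed.

Lemma eigenvalue_kron_johnson a :
  eigenvalue (distmx R (kron_rel (@complete_rel n) (@johnson_rel m r))) a <->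
  exists2 k, (k <= r)%N &
    a = johnson_ev (m := m) (r := r) k +
        (2 * n%:R - 2 + n%:R * johnson_dist_ev (m := m) (r := r) k) \/
    a = johnson_ev (m := m) (r := r) k - 2.
Proof.
apply: iff_trans (filtered_eigenvalue _ _ _ _ _ kron_weight_separates kron_weight_triangular) _.
split=> [[[o S] [f [-> _ fS]]]|[k kr]].
  exists #|S|; last by case: o fS => [z|] _; [right | left].
  (* Levels above [r] carry only zero functionals. *)
  rewrite leqNgt; apply: contra fS => rS.
  by rewrite big1 // => t _; rewrite kron_weight_eq0 ?mulr0.
have z : 'I_n by exists 0%N; lia.
case=> ->.
  have [[o S] [f [/= -> Sk flow fS]]] := kron_ev_attained None k kr.
  by exists (None, S), f; rewrite /kron_ev /= Sk.
have [[o S] [f [/= -> Sk flow fS]]] := kron_ev_attained (Some z) k kr.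
by exists (Some z, S), f; rewrite /kron_ev /= Sk.
Qed.
End Kronecker.

(** * Sorting the diagonal entries into the four families *)

Theorem theorem4p6 (R : realFieldType) (n m r : nat)
  (hn : (3 <= n)%N) (hr : (1 <= r)%N) (hm2r : (2 * r <= m)%N) (hm : (3 <= m)%N) :
  let lam := fun i : nat => ((r - i) * (m - r - i))%:R - i%:R : R in
  let s := (\sum_(j < r.+1) j * 'C(r, j) * 'C(m - r, j))%N in
  forall a : R,
    eigenvalue (distmx R (kron_rel (@complete_rel n) (@johnson_rel m r))) a <->
    [\/ a = 2 * n%:R - 2 + n%:R * s%:R + lam 0%N,
        a = 2 * n%:R - 2 - n%:R * s%:R / (m%:R - 1) + lam 1%N,
        (exists2 i : nat, (2 <= i <= r)%N & a = 2 * n%:R - 2 + lam i)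
      | (exists2 i : nat, (i <= r)%N & a = lam i - 2)].
Proof.
move=> lam s a; apply: iff_trans (eigenvalue_kron_johnson hn hr hm2r hm a) _.
rewrite /johnson_dist_ev /johnson_ev -/s.
split=> [[k kr [->|->]]|].
- case: k kr => [|[|k]] kr; [apply: Or41 | apply: Or42 | apply: Or43]; rewrite /lam.
  + by ring.
  + by ring.
  by exists k.+2 => //; ring.
- by apply: Or44; exists k.
case=> [->|->|[i /andP [i2 ir] ->]|[i ir ->]].
- by exists 0%N => //; left; rewrite /lam; ring.
- by exists 1%N => //; left; rewrite /lam; ring.
- by exists i => //; left; case: i i2 {ir} => [|[|i]] // _; rewrite /lam; ring.
by exists i => //; right.
Qed.
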